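(* Let $p$ be an odd prime, let $e,r$ be integers with $e\ge 1$ and $1\le r\le p-1$, and put $m=er+(e-1)(p-r-1)+1$; assume $m\ge 3$. Let $G=\langle s_1,\dots,s_{p-1},\beta\rangle$ be the group of order $p^m$ defined by the following relations: $s_i^{p^e}=1$ for $1\le i\le r$; $s_i^{p^{e-1}}=1$ for $r+1\le i\le p-1$; $\beta^p=1$; $[s_i,s_j]=1$ for $1\le i,j\le p-1$; $s_{k+1}=[s_k,\beta]$ for $1\le k\le p-2$; and $[s_{p-1},\beta]=s_1^{-\binom{p}{1}}s_2^{-\binom{p}{2}}\cdots s_{p-1}^{-\binom{p}{p-1}}$. Let $\sigma,\tau$ be the automorphisms of $G$ determined by $\sigma: s_1\mapsto s_1,\ \beta\mapsto\beta^{-1}$ and $\tau: s_1\mapsto s_1^{-1},\ \beta\mapsto\beta$, and let $R=G\rtimes\langle\sigma,\tau\rangle$. Then $R$ is the automorphism group of an abstract regular $3$-polytope of order $4p^m$ with type $\{p,2p\}$; equivalently, $|R|=4p^m$ and there exist involutions $\rho_0,\rho_1,\rho_2\in R$ such that $(R,\{\rho_0,\rho_1,\rho_2\})$ is a string C-group of rank $3$ and type $\{p,2p\}$.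
   Context: Conventions: $[x,y]=x^{-1}y^{-1}xy$ and $x^y=y^{-1}xy$. Facts about $G$ (from the literature): $G$ has order $p^m$ and is generated by $s_1$ and $\beta$; the subgroup $A=\langle s_1,\dots,s_{p-1}\rangle$ is an abelian (normal) maximal subgroup of $G$; and every $x\in G\setminus A$ has order $p$. The assignments defining $\sigma$ and $\tau$ on the generators $s_1,\beta$ extend to automorphisms of $G$, and $\langle\sigma,\tau\rangle$ denotes the subgroup of $\mathrm{Aut}(G)$ they generate, acting naturally on $G$ in the semidirect product $R$. String C-groups: Let $H$ be a group and $S=\{\rho_0,\dots,\rho_{d-1}\}$ a generating set of $H$ consisting of involutions. For $I\subseteq\{0,\dots,d-1\}$ let $H_I=\langle\rho_i: i\in I\rangle$. The pair $(H,S)$ is a string C-group of rank $d$ if (string property) $\rho_i$ and $\rho_j$ commute whenever $|i-j|>1$, and (intersection property) $H_I\cap H_J=H_{I\cap J}$ for all $I,J\subseteq\{0,\dots,d-1\}$. Its order is $|H|$, and its (Schläfli) type is $\{p_1,\dots,p_{d-1}\}$, where $p_i$ is the order of $\rho_{i-1}\rho_i$. String C-groups of rank $d$ are the same as automorphism groups of abstract regular $d$-polytopes (with distinguished generators), with the order and type of the polytope being those of the string C-group. *)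

(* Defs.v *)
From HB Require Import structures.
From mathcomp Require Import all_boot all_order all_fingroup all_algebra.

Set Implicit Arguments.
Unset Strict Implicit.
Unset Printing Implicit Defensive.

Local Open Scope nat_scope.
Local Open Scope group_scope.

(* Only the values s 1, ..., s p.-1 of [s] are meaningful. *)
Definition G_relations (p e r : nat) (H : groupType) (s : nat -> H) (b : H) :
    Prop :=
  [/\ forall i, (1 <= i <= r)%N -> s i ^+ (p ^ e)%N = 1,
      forall i, (r < i <= p - 1)%N -> s i ^+ (p ^ (e - 1))%N = 1 &
      b ^+ p = 1] /\
  [/\ forall i j, (1 <= i <= p - 1)%N -> (1 <= j <= p - 1)%N ->
        [~ s i, s j] = 1,
      forall k, (1 <= k <= p - 2)%N -> s k.+1 = [~ s k, b] &
      [~ s (p - 1)%N, b] = \prod_(1 <= i < p) (s i) ^- 'C(p, i)].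

(* [H] is the group presented by the generators s_1, ..., s_(p-1), b and the
   relations above: it is universal among all (possibly infinite) groups with
   such elements. Uniqueness of [f] says that the generators generate [H]. *)
Definition G_presented (p e r : nat) (H : groupType) (s : nat -> H) (b : H) :
    Prop :=
  G_relations p e r s b /\
  forall (K : groupType) (t : nat -> K) (c : K), G_relations p e r t c ->
    let maps_gens (f : {multiplicative H -> K}) :=
      (forall i, (1 <= i <= p - 1)%N -> f (s i) = t i) /\ f b = c in
    (exists f, maps_gens f) /\
    (forall f g, maps_gens f -> maps_gens g -> f =1 g).

Lemma gen2_Aut (gT : finGroupType) (G : {group gT}) (a1 a2 : {perm gT}) :
  a1 \in Aut G -> a2 \in Aut G -> <<[set a1; a2]>> \subset Aut G.
Proof. by move=> Aa1 Aa2; rewrite gen_subG subUset !sub1set Aa1. Qed.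

(* The external semidirect product of [G] by a group [A] of automorphisms of
   [G], acting naturally. *)
Definition Aut_sdprod (gT : finGroupType) (G : {group gT})
    (A : {group {perm gT}}) (sAG : A \subset Aut G) : finGroupType :=
  sdprod_by ([Aut G] \ sAG)%gact.

Section StringCGroup.

Variables (gT : finGroupType) (d : nat).
Implicit Types (H : {group gT}) (rho : 'I_d -> gT).

Definition parabolic rho (I : {set 'I_d}) : {set gT} :=
  <<[set rho i | i in I]>>.

Definition string_property rho : Prop :=
  forall i j : 'I_d, (1 < `|(i : nat) - (j : nat)|)%N ->
    commute (rho i) (rho j).

Definition intersection_property rho : Prop :=
  forall I J : {set 'I_d},
    parabolic rho I :&: parabolic rho J = parabolic rho (I :&: J).

(* The rho i are automatically distinct: if i != j and rho i = rho j then the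
   intersection property for [set i] and [set j] gives rho i = 1. *)
Definition string_C_group H rho : Prop :=
  [/\ parabolic rho [set: 'I_d] = H,
      forall i, #[rho i] = 2,
      string_property rho &
      intersection_property rho].

End StringCGroup.

Definition schlafli_type (gT : finGroupType) (d : nat) (rho : 'I_d.+1 -> gT) :
    seq nat :=
  [seq #[rho (inord i.-1) * rho (inord i)] | i <- iota 1 d].

(* Main.v *)
Require Import Defs.
From HB Require Import structures.
From mathcomp Require Import all_boot all_order all_fingroup all_algebra.
From mathcomp Require Import all_solvable.
From mathcomp Require Import zify.

Set Implicit Arguments.
Unset Strict Implicit.
Unset Printing Implicit Defensive.

Local Open Scope nat_scope.
Local Open Scope group_scope.

(* Put g = s_1 beta s_1, which sigma tau inverts, and take
     rho_0 = sigma tau,  rho_1 = sigma tau g,  rho_2 = sigma.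
   Then rho_0 rho_1 = g is conjugate to beta s_1^2, whose p-th power is
   the norm of s_1^2 under beta; the relation for [s_(p-1), beta] says exactly
   that this norm is trivial. As (rho_1 rho_2)^2 is conjugate to beta^-2 and
   rho_1 rho_2 lies outside G, it has order 2p. The rho_i generate s_1 and beta
   because square roots are unique in odd order. For the intersection property,
   given incomparable I and J, one of H_I, H_J contains H_(I & J) with prime
   index, and no rho_i lies in the subgroup generated by the other two, which
   has order at most 4p < |R|. *)

(** * Powers of [b * t 1] along a chain of commutators with [b] *)

Section NormOfCommutatorChain.

Variables (gT : finGroupType) (A : {group gT}) (b : gT) (t : nat -> gT).
Hypothesis abA : abelian A.

Lemma prodg_abelian_split (f g : nat -> gT) n :
    (forall i, (1 <= i <= n)%N -> f i \in A) ->
    (forall i, (1 <= i <= n)%N -> g i \in A) ->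
  \prod_(1 <= i < n.+1) (f i * g i) =
    (\prod_(1 <= i < n.+1) f i) * \prod_(1 <= i < n.+1) g i.
Proof.
elim: n => [|n IHn] fA gA; first by rewrite !big_nil mulg1.
rewrite !(@big_nat_recr _ _ _ n.+1) //= {}IHn => [|i lein|i lein]; last 2 first.
- by apply: fA; lia.
- by apply: gA; lia.
have gPA: \prod_(1 <= i < n.+1) g i \in A.
  by rewrite big_nat; apply: group_prod => i lein; apply: gA; lia.
have fnA: f n.+1 \in A by apply: fA; lia.
rewrite -!mulgA; congr (_ * _); rewrite !mulgA; congr (_ * _).
exact: (centsP abA).
Qed.

(* In the module A with x acting as conjugation by b minus 1, this is the
   identity 1 + (1+x) + ... + (1+x)^(n-1) = sum_i C(n,i) x^(i-1). *)
Lemma expg_mul_chain p :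
    (forall i, (1 <= i <= p)%N -> t i \in A) ->
    (forall i, (1 <= i < p)%N -> t i ^ b = t i * t i.+1) ->
  forall n, (n <= p)%N ->
    (b * t 1%N) ^+ n = b ^+ n * \prod_(1 <= i < n.+1) t i ^+ 'C(n, i).
Proof.
move=> tA tJ; elim=> [|n IHn] le_n_p; first by rewrite big_nil mulg1.
rewrite expgSr {}IHn ?(ltnW le_n_p) // [b ^+ n.+1]expgSr mulgA.
rewrite -!(mulgA (b ^+ n)).
(* Moving the new [b] to the left past the product conjugates the product by [b]. *)
congr (_ * _); rewrite (conjgC _ b) -mulgA; congr (_ * _).
pose P m := \prod_(1 <= i < m.+1) t i ^+ 'C(n, i).
have PJ: P n ^ b = P n * \prod_(1 <= i < n.+1) t i.+1 ^+ 'C(n, i).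
  rewrite -prodg_abelian_split => [|i lein|i lein].
  - rewrite /P (big_morph (conjg^~ b) (fun x y => conjMg x y b) (conj1g b)).
    apply: eq_big_nat => i lein; rewrite conjXg tJ; last lia.
    rewrite expgMn //; apply: (centsP abA); apply: tA; lia.
  - by rewrite groupX // tA; lia.
  - by rewrite groupX // tA; lia.
(* Pascal's rule splits each exponent; the index [i] starts at 1, so [i.-1] is a true
   predecessor. *)
have ->: \prod_(1 <= i < n.+2) t i ^+ 'C(n.+1, i)
    = P n.+1 * \prod_(1 <= i < n.+2) t i ^+ 'C(n, i.-1).
  rewrite -prodg_abelian_split => [|i lein|i lein].
  - by apply: eq_big_nat => -[|i] // _; rewrite binS expgD.
  - by rewrite groupX // tA; lia.
  - by rewrite groupX // tA; lia.
have ->: P n.+1 = P n.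
  by rewrite /P (@big_nat_recr _ _ _ n.+1) //= bin_small // mulg1.
rewrite [X in P n * X]big_nat_recl //= bin0 expg1.
change (P n ^ b * t 1%N =
  P n * (t 1%N * \prod_(1 <= i < n.+1) t i.+1 ^+ 'C(n, i))).
rewrite PJ -mulgA; congr (_ * _).
have QA: \prod_(1 <= i < n.+1) t i.+1 ^+ 'C(n, i) \in A.
  rewrite big_nat; apply: group_prod => i lein.
  by rewrite groupX // tA; lia.
by apply: (centsP abA) => //; apply: tA; lia.
Qed.

End NormOfCommutatorChain.

(** * Dihedral groups generated by two involutions *)

Section Involutions.

Variables (gT : finGroupType) (x y : gT).
Hypotheses (ox : #[x] = 2) (oy : #[y] = 2).

(** Conjugation by [y] inverts [x * y], so [y] normalises the cyclic group it generates. *)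
Lemma involutions_gen_mulG : <<[set x; y]>> = <[x * y]> * <[y]>.
Proof.
have x2: x * x = 1 by rewrite -[LHS]/(x ^+ 2) -ox expg_order.
have y2: y * y = 1 by rewrite -[LHS]/(y ^+ 2) -oy expg_order.
have ix: x^-1 = x by apply: (mulgI x); rewrite mulgV x2.
have iy: y^-1 = y by apply: (mulgI y); rewrite mulgV y2.
have nyxy: <[y]> \subset 'N(<[x * y]>).
  rewrite cycle_subG; apply/normP; rewrite -cycleJ -[RHS]cycleV; congr <[_]>.
  by rewrite /conjg invMg ix iy -!mulgA y2 mulg1.
rewrite -norm_joinEr //; apply/eqP; rewrite eqEsubset; apply/andP; split.
  have Jy: y \in <[x * y]> <*> <[y]>.
    by rewrite (subsetP (joing_subr _ _)) ?cycle_id.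
  rewrite gen_subG subUset !sub1set Jy andbT -(groupMr x Jy).
  by rewrite (subsetP (joing_subl _ _)) ?cycle_id.
by rewrite join_subG !cycle_subG groupM ?mem_gen ?inE ?eqxx ?orbT.
Qed.

Lemma card_involutions_gen : x != y -> #|<<[set x; y]>>| = (2 * #[x * y])%N.
Proof.
(* Otherwise [x] lies there too, and a cyclic group has at most one subgroup of order 2. *)
move=> ne_xy; have xy'y: y \notin <[x * y]>.
  apply: contra ne_xy => xy_y; have xy_x: x \in <[x * y]>.
    by rewrite -(groupMr x xy_y) cycle_id.
  have /eqP/setP/(_ x): <[x]> == <[y]>.
    rewrite (eq_subG_cyclic (cycle_cyclic (x * y))) ?cycle_subG //.
    by rewrite -!orderE ox oy.
  rewrite cycle_id [in RHS]cycle2g // !inE => /esym/pred2P[x1 | ->] //.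
  by move: ox; rewrite x1 order1.
rewrite involutions_gen_mulG TI_cardMg -?orderE ?oy 1?mulnC //.
by rewrite setIC prime_TIg ?cycle_subG // -orderE oy.
Qed.

(** This bound also covers [x = y]. It serves to prove the independence of the generators, from
    which their distinctness is then deduced. *)
Lemma leq_card_involutions_gen : (#|<<[set x; y]>>| <= 2 * #[x * y])%N.
Proof.
rewrite involutions_gen_mulG mulnC -[in X in (_ <= X)%N]oy !orderE mul_cardG.
by rewrite leq_pmulr // cardG_gt0.
Qed.

End Involutions.

(** A subgroup of prime index is maximal, and the intersection lies between [K] and [H1] without
    being [H1]. *)
Lemma prime_index_setI_eq (gT : finGroupType) (H1 H2 K : {group gT}) :
    K \subset H1 -> K \subset H2 -> prime #|H1 : K| -> ~~ (H1 \subset H2) ->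
  H1 :&: H2 = K :> {set gT}.
Proof.
move=> sKH1 sKH2 pr_index nsH12.
have sKI: K \subset H1 :&: H2 by rewrite subsetI sKH1.
have /maximal_eqP[_ maxK]: maximal_eq K H1.
  by rewrite /maximal_eq p_index_maximal ?orbT.
case: (maxK (H1 :&: H2)%G sKI (subsetIl _ _)) => [<- // | /= eqI].
by case/negP: nsH12; rewrite -eqI subsetIr.
Qed.

(** * The intersection property in rank 3, from independence and prime indices *)

Section RankThree.

Variables (gT : finGroupType) (rho : 'I_3 -> gT).
Implicit Types (I J K : {set 'I_3}) (i j : 'I_3).

Lemma parabolicS I J : I \subset J -> parabolic rho I \subset parabolic rho J.
Proof. by move=> sIJ; rewrite genS ?imsetS. Qed.

Lemma parabolic1 i : parabolic rho [set i] = <[rho i]>.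
Proof. by rewrite /parabolic imset_set1. Qed.

Lemma parabolic2 i j : parabolic rho [set i; j] = <<[set rho i; rho j]>>.
Proof. by rewrite /parabolic imsetU1 imset_set1. Qed.

Hypothesis orho : forall i, #[rho i] = 2.
Hypothesis indep : forall i, rho i \notin parabolic rho [set~ i].
Hypothesis prime_rho0M : forall i, i != 0%R -> prime #[rho 0%R * rho i].

Lemma rho_inj i j : i != j -> rho i != rho j.
Proof.
move=> ne_ij; apply: contra (indep i) => /eqP ->.
by rewrite mem_gen // imset_f // !inE eq_sym.
Qed.

Lemma index_parabolic2 i j : i != j ->
  #|parabolic rho [set i; j] : parabolic rho [set i]| = #[rho i * rho j].
Proof.
move=> ne_ij; rewrite parabolic1 parabolic2.
rewrite -divgS ?cycle_subG ?mem_gen ?set21 //.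
by rewrite card_involutions_gen ?rho_inj // -orderE orho mulKn.
Qed.

Lemma parabolicI_prime_index I J K :
    I :&: J = K -> prime #|parabolic rho I : parabolic rho K| ->
    ~~ (I \subset J) ->
  parabolic rho I :&: parabolic rho J = parabolic rho K.
Proof.
move=> defK pr_index nsIJ; apply: prime_index_setI_eq => //.
- by apply: parabolicS; rewrite -defK subsetIl.
- by apply: parabolicS; rewrite -defK subsetIr.
(* Non-inclusion of index sets passes to the subgroups: an [i] in [I] but not in [J] would
   contradict independence. *)
have [i Ii J'i] := subsetPn nsIJ.
apply: contra (indep i) => sIJ.
have /subsetP: parabolic rho J \subset parabolic rho [set~ i].
  by apply: parabolicS; rewrite subsetC sub1set inE.
by apply; apply: (subsetP sIJ); rewrite mem_gen ?imset_f.
Qed.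

Lemma parabolicI_set1 I J : #|I| = 1%N -> ~~ (I \subset J) ->
  parabolic rho I :&: parabolic rho J = parabolic rho (I :&: J).
Proof.
move/eqP/cards1P=> [i ->]; rewrite sub1set => J'i.
have I0: [set i] :&: J = set0 by apply/disjoint_setI0; rewrite disjoints1.
apply: parabolicI_prime_index; rewrite ?sub1set //.
(* The prime index is here 2, that of the trivial group in the group generated by one involution. *)
by rewrite I0 parabolic1 /parabolic imset0 gen0 indexg1 -orderE orho.
Qed.

(** Primality is assumed only for products with [rho 0], so the set containing 0 has to be the one
    in which the intersection has prime index. *)
Lemma parabolicI_set2 I J : #|I| = 2 -> #|J| = 2 -> 0%R \in I -> I != J ->
  parabolic rho I :&: parabolic rho J = parabolic rho (I :&: J).
Proof.
move=> I2 J2 I0 ne_IJ.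
have nsIJ: ~~ (I \subset J) by apply: contra ne_IJ; rewrite eqEcard I2 J2 andbT.
have /cards1P[i defI]: #|I :\ 0%R| == 1%N.
  by move/eqP: I2; rewrite (cardsD1 0%R I) I0.
have i_neq0: i != 0%R by have := set11 i; rewrite -defI !inE => /andP[].
have{defI} defI: I = [set 0%R; i] by rewrite -(setD1K I0) defI.
apply: parabolicI_prime_index => //.
case: (boolP (0%R \in J)) => J0.
  have -> : I :&: J = [set 0%R].
    apply/setP=> j; rewrite defI !inE.
    case: eqP => [-> // | _] /=; case: eqP => // -> /=; apply: contraNF nsIJ.
    by rewrite defI subUset !sub1set J0.
  by rewrite defI index_parabolic2 ?prime_rho0M // eq_sym.
have defJ: J = [set~ 0%R].
  apply/eqP; rewrite eqEcard cardsC1 card_ord J2 andbT.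
  by rewrite subsetC sub1set inE.
have -> : I :&: J = [set i].
  apply/setP=> j; rewrite defI defJ !inE.
  by case: eqP => [->|_]; rewrite ?andbF ?andbT // eq_sym (negPf i_neq0).
(* The index is the order of [rho i * rho 0], whose inverse is [rho 0 * rho i] because both factors
   are involutions. *)
rewrite defI setUC index_parabolic2 // -orderV invMg.
rewrite !invg_expg !orho !expg1.
exact: prime_rho0M.
Qed.

Lemma rank3_intersection_property : intersection_property rho.
Proof.
move=> I J; case: (boolP (I \subset J)) => [sIJ | nsIJ].
  by rewrite (setIidPl sIJ); apply/setIidPl/parabolicS.
case: (boolP (J \subset I)) => [sJI | nsJI].
  by rewrite (setIidPr sJI); apply/setIidPr/parabolicS.
have card12 K K' : ~~ (K \subset K') -> ~~ (K' \subset K) ->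
    #|K| = 1%N \/ #|K| = 2.
  move=> nsKK' nsK'K; have K_gt0: (0 < #|K|)%N.
    by rewrite card_gt0; apply: contraNneq nsKK' => ->; apply: sub0set.
  have: (#|K| < #|'I_3|)%N.
    rewrite -cardsT proper_card // properT; apply: contraNneq nsK'K => ->.
    exact: subsetT.
  by rewrite card_ord; case: #|K| K_gt0 => [|[|[|?]]] //; auto.
case: (card12 I J) => // [I1 | I2]; first exact: parabolicI_set1.
case: (card12 J I) => // [J1 | J2].
  by rewrite setIC [I :&: J]setIC; apply: parabolicI_set1.
have ne_IJ: I != J by apply: contraNneq nsIJ => ->.
case: (boolP (0%R \in I)) => I0; first exact: parabolicI_set2.
case: (boolP (0%R \in J)) => J0.
  by rewrite setIC [I :&: J]setIC; apply: parabolicI_set2; rewrite // eq_sym.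
(* Only one two-element subset omits 0, so two distinct ones cannot both do so. *)
case/negP: ne_IJ; have C2: #|[set~ 0%R : 'I_3]| = 2 by rewrite cardsC1 card_ord.
have defC K : 0%R \notin K -> #|K| = 2 -> K = [set~ 0%R].
  by move=> K0 K2; apply/eqP; rewrite eqEcard C2 K2 subsetC sub1set inE K0.
by rewrite (defC I) // (defC J).
Qed.

End RankThree.

(** For odd order [n], [x] is the power of [x ^+ 2] with exponent [(n + 1) / 2]. *)
Lemma odd_order_mem_sqr (gT : finGroupType) (H : {group gT}) (x : gT) :
  odd #[x] -> x ^+ 2 \in H -> x \in H.
Proof.
move=> odd_x Hx2; have -> : x = (x ^+ 2) ^+ (#[x].+1)./2.
  rewrite -expgM mul2n -[_./2.*2]add0n; have := odd_double_half #[x].+1.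
  by rewrite oddS odd_x => ->; rewrite expgS expg_order mulg1.
exact: groupX.
Qed.

Lemma order2_sqr1 (gT : finGroupType) (x : gT) :
  x != 1 -> x * x = 1 -> #[x] = 2.
Proof. by move=> x1 xx; apply: nt_prime_order. Qed.

Lemma I3_cases (P : 'I_3 -> Prop) : P 0%R -> P 1%R -> P 2%R -> forall i, P i.
Proof.
move=> P0 P1 P2 [[|[|[|//]]] lti3].
- by rewrite (_ : Ordinal lti3 = 0%R) //; apply: val_inj.
- by rewrite (_ : Ordinal lti3 = 1%R) //; apply: val_inj.
- by rewrite (_ : Ordinal lti3 = 2%R) //; apply: val_inj.
Qed.

(** * The three involutions inside one finite group, where [s], [b], [u], [t] stand for [s_1],
    [beta], [sigma], [tau] *)

Section TwistedGroup.

Variables (gT : finGroupType) (R : {group gT}) (p : nat) (s b u t : gT).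
Hypotheses (p_prime : prime p) (p_odd : odd p).
Hypotheses (su : s ^ u = s) (bu : b ^ u = b^-1).
Hypotheses (st : s ^ t = s^-1) (bt : b ^ t = b).
Hypotheses (ou : #[u] = 2) (ot : #[t] = 2) (cut : commute u t).
Hypotheses (ob : #[b] = p) (os : odd #[s]) (bs_p : (b * s ^+ 2) ^+ p = 1).
Hypothesis N't : t \notin <<[set s; b]>>.
Hypothesis defR : <<[set s; b]>> <*> <<[set u; t]>> = R.
Hypothesis cardR : (4 * p < #|R|)%N.

(* The palindrome g is inverted by u * t, so that u * t * g is an involution. *)
Let g := s * b * s.

Let g_u : g ^ u = s * b^-1 * s.
Proof. by rewrite !conjMg su bu. Qed.

Let g_ut : g ^ (u * t) = g^-1.
Proof. by rewrite conjgM g_u !conjMg conjVg st bt /g !invMg mulgA. Qed.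

(** This commutator of [g] and [u] has two uses: its order [p] shows that [g] is nontrivial, and it
    yields [b ^ s] in the generation argument. *)
Let gV_gu : g^-1 * g ^ u = (b ^- 2) ^ s.
Proof. by rewrite g_u /g /conjg expgS expg1 !invMg !mulgA mulgKV. Qed.

Let order_b2 : #[b ^+ 2] = p.
Proof. by rewrite orderXgcd ob (eqP (_ : coprime p 2)) ?divn1 ?coprimen2. Qed.

Let order_gV_gu : #[g^-1 * g ^ u] = p.
Proof. by rewrite gV_gu orderJ orderV order_b2. Qed.

Let order_g : #[g] = p.
Proof.
have gp: g ^+ p = 1.
  have -> : g = (b * s ^+ 2) ^ s^-1 by rewrite /g /conjg invgK !mulgA mulgK.
  by rewrite -conjXg bs_p conj1g.
have /primeP[p_gt1 p_div] := p_prime.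
have /p_div: #[g] %| p by rewrite order_dvdn gp.
case/pred2P=> // /eqP; rewrite order_eq1 => /eqP g1.
by move: order_gV_gu p_gt1; rewrite g1 conj1g invg1 mulg1 order1 => <-.
Qed.

Let r0 := u * t.
Let r1 := u * t * g.
Let r2 := u.

Let uu : u * u = 1. Proof. by rewrite -[LHS]/(u ^+ 2) -ou expg_order. Qed.
Let tt' : t * t = 1. Proof. by rewrite -[LHS]/(t ^+ 2) -ot expg_order. Qed.

Let r0r0 : r0 * r0 = 1.
Proof. by rewrite /r0 {2}cut mulgA -(mulgA u) tt' mulg1 uu. Qed.

Let r0V : r0^-1 = r0.
Proof. by apply: (mulgI r0); rewrite mulgV r0r0. Qed.

Let uV : u^-1 = u.
Proof. by apply: (mulgI u); rewrite mulgV uu. Qed.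

Let order_r0 : #[r0] = 2.
Proof.
(* If [r0] were trivial, [g] would be its own inverse, and the odd prime [p] would divide 2. *)
apply: order2_sqr1 r0r0; apply/negP=> /eqP r0_1.
have := g_ut; rewrite -/r0 r0_1 conjg1 => gV.
have: g ^+ 2 == 1 by rewrite expgS expg1 {1}gV mulVg.
rewrite -order_dvdn order_g dvdn_prime2 // => /eqP p2.
by move: p_odd; rewrite p2.
Qed.

Let order_r1 : #[r1] = 2.
Proof.
apply: order2_sqr1; last first.
  have := g_ut; rewrite -/r0 /conjg r0V => gr0.
  by rewrite /r1 -/r0 -mulgA (mulgA g) (mulgA r0) gr0 mulVg.
apply/negP=> /eqP; rewrite /r1 -/r0 => r0g.
have gr0: g = r0 by rewrite -r0V; apply: (mulgI r0); rewrite r0g mulgV.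
have := order_g; rewrite gr0 order_r0 => p2.
by move: p_odd; rewrite -p2.
Qed.

Let r0r1 : r0 * r1 = g.
Proof. by rewrite /r1 mulgA r0r0 mul1g. Qed.

Let r0r2 : commute r0 r2.
Proof. by rewrite /commute /r0 /r2 -mulgA -cut. Qed.

Let r1r2 : r1 * r2 = t * g ^ u.
Proof. by rewrite /r1 /r2 cut /conjg uV !mulgA. Qed.

Let r1r2_sqr : (r1 * r2) ^+ 2 = (b ^- 2) ^ s.
Proof.
have tV: t^-1 = t by apply: (mulgI t); rewrite mulgV tt'.
have -> : (r1 * r2) ^+ 2 = (g ^ u) ^ t * g ^ u.
  by rewrite r1r2 expgS expg1 (conjgE (g ^ u)) tV !mulgA.
by rewrite g_u !conjMg conjVg st bt /conjg expgS expg1 !invMg !mulgA mulgKV.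
Qed.

Let order_r1r2 : #[r1 * r2] = (2 * p)%N.
Proof.
pose z := r1 * r2; pose N := <<[set s; b]>>; rewrite -/z.
have [Ns Nb] : s \in N /\ b \in N by rewrite !mem_gen ?inE ?eqxx ?orbT.
have Nz2: z ^+ 2 \in N by rewrite r1r2_sqr groupJ ?groupV ?groupX.
have oz2: #[z ^+ 2] = p by rewrite r1r2_sqr orderJ orderV order_b2.
(* Since [z] is [t] times an element of [N], it lies outside [N]; having its square in [N], it
   cannot have odd order. *)
have even_z: ~~ odd #[z].
  apply: contra N't => odd_z.
  have Ngu: g ^ u \in N by rewrite g_u groupM // groupM // groupV.
  suffices: z \in N by rewrite /z r1r2 groupMr.
  exact: odd_order_mem_sqr.
by rewrite -oz2 orderXdiv ?dvdn2 // mulnC divnK ?dvdn2.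
Qed.

Lemma gen_three_involutions : <<[set r0; r1; r2]>> = R.
Proof.
set H := <<_>>.
have [H0 H1 H2]: [/\ r0 \in H, r1 \in H & r2 \in H].
  by split; rewrite mem_gen // !inE eqxx ?orbT.
have Hg: g \in H by rewrite -r0r1 groupM.
have Ht: t \in H by rewrite -(mulKg u t) groupM ?groupV.
have Hbs: b ^ s \in H.
  apply: odd_order_mem_sqr; first by rewrite orderJ ob.
  by rewrite -conjXg -groupV -conjVg -gV_gu groupM ?groupV // groupJ.
have Hs: s \in H.
  (* The product of [s ^+ 2] and [b ^ s] is [g]. *)
  apply: odd_order_mem_sqr => //; rewrite -(groupMr _ Hbs).
  by rewrite expgS expg1 /conjg !mulgA mulgK.
have Hb: b \in H by rewrite -(conjgK s b) groupJ ?groupV.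
apply/eqP; rewrite eqEsubset -defR; apply/andP; split; last first.
  by rewrite join_subG !gen_subG !subUset !sub1set Hs Hb H2 Ht.
pose J := <<[set s; b]>> <*> <<[set u; t]>>; rewrite -/J.
have [Ju Jt]: u \in J /\ t \in J.
  by split; rewrite (subsetP (joing_subr _ _)) // mem_gen ?set21 ?set22.
have Jg: g \in J.
  by rewrite (subsetP (joing_subl _ _)) // !groupM // mem_gen ?set21 ?set22.
have J0: r0 \in J by apply: groupM.
by rewrite gen_subG !subUset !sub1set J0 Ju groupM.
Qed.

Definition twisted_rho (i : 'I_3) : gT := nth 1 [:: r0; r1; r2] i.

Lemma order_twisted_rho i : #[twisted_rho i] = 2.
Proof.
by elim/I3_cases: i; rewrite /twisted_rho /= ?order_r0 ?order_r1 ?ou.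
Qed.

Lemma parabolic_twisted_rhoT : parabolic twisted_rho [set: 'I_3] = R.
Proof.
rewrite -gen_three_involutions /parabolic; congr <<_>>.
apply/setP=> x; rewrite !inE -!orbA.
apply/imsetP/or3P=> [[i _ ->]|].
  elim/I3_cases: i; rewrite /twisted_rho /=; rewrite eqxx.
  - by constructor 1.
  - by constructor 2.
  - by constructor 3.
by case=> /eqP ->; [exists 0%R | exists 1%R | exists 2%R].
Qed.

Let rho0M2 : twisted_rho 0%R * twisted_rho 2%R = t.
Proof. by rewrite /twisted_rho /= r0r2 mulgA uu mul1g. Qed.

Lemma prime_order_twisted_rho0M i :
  i != 0%R -> prime #[twisted_rho 0%R * twisted_rho i].
Proof.
elim/I3_cases: i => // _; first by rewrite /twisted_rho /= r0r1 order_g.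
by rewrite rho0M2 ot.
Qed.

Lemma twisted_rho_indep i : twisted_rho i \notin parabolic twisted_rho [set~ i].
Proof.
(* The three pairwise products have orders [2 * p], 2 and [p], so one bound serves all three
   cases. *)
have indep j k : [set~ i] = [set j; k] ->
    (#[twisted_rho j * twisted_rho k] <= 2 * p)%N ->
    twisted_rho i \notin parabolic twisted_rho [set~ i].
  move=> defC le_jk; apply/negP=> Pi.
  have: R \subset parabolic twisted_rho [set~ i].
    rewrite -parabolic_twisted_rhoT gen_subG; apply/subsetP=> _ /imsetP[l _ ->].
    case: (eqVneq l i) => [-> // | ne_li]; rewrite mem_gen // imset_f //.
    by rewrite !inE.
  move/subset_leq_card; rewrite leqNgt; case/negP.
  apply: leq_ltn_trans cardR; rewrite defC parabolic2.
  have orho := order_twisted_rho.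
  apply: leq_trans (leq_card_involutions_gen (orho j) (orho k)) _.
  by rewrite -[4]/(2 * 2)%N -mulnA leq_mul2l.
elim/I3_cases: i indep => indep.
- apply: (indep 1%R 2%R); last by rewrite order_r1r2.
  by apply/setP; elim/I3_cases; rewrite !inE.
- apply: (indep 0%R 2%R); first by apply/setP; elim/I3_cases; rewrite !inE.
  by rewrite rho0M2 ot leq_pmulr ?prime_gt0.
- apply: (indep 0%R 1%R); first by apply/setP; elim/I3_cases; rewrite !inE.
  by rewrite /twisted_rho /= r0r1 order_g leq_pmull.
Qed.

Lemma string_C_group_twisted_rho : string_C_group R twisted_rho.
Proof.
split.
- exact: parabolic_twisted_rhoT.
- exact: order_twisted_rho.
- by elim/I3_cases; elim/I3_cases => // _; apply/esym/r0r2.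
- exact: (rank3_intersection_property order_twisted_rho twisted_rho_indep
    prime_order_twisted_rho0M).
Qed.

Lemma schlafli_twisted_rho : schlafli_type twisted_rho = [:: p; (2 * p)%N].
Proof.
by rewrite /schlafli_type /= /twisted_rho !inordK //= r0r1 order_g order_r1r2.
Qed.

End TwistedGroup.

(** * Consequences of the presentation of [G] *)

Lemma G_relations_inj (p e r : nat) (K H : groupType)
    (f : UMagmaMorphism.type K H) (s : nat -> H) (b : H)
    (t : nat -> K) (c : K) :
    (1 <= r <= p - 1)%N -> injective f ->
    (forall i, (1 <= i <= p - 1)%N -> f (t i) = s i) -> f c = b ->
  G_relations p e r s b -> G_relations p e r t c.
Proof.
move=> r_bounds f_inj ft fc [[r1 r2 r3] [r4 r5 r6]].
split; split.
- move=> i le_i; apply: f_inj; rewrite gmulfXn ft ?gmulf1 ?r1 //; lia.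
- move=> i le_i; apply: f_inj; rewrite gmulfXn ft ?gmulf1 ?r2 //; lia.
- by apply: f_inj; rewrite gmulfXn fc r3 gmulf1.
- by move=> i j le_i le_j; apply: f_inj; rewrite gmulfR !ft // gmulf1 r4.
- move=> k le_k; apply: f_inj; rewrite gmulfR fc !ft ?r5 //; lia.
- apply: f_inj; rewrite gmulfR fc ft ?r6; last lia.
  rewrite gmulf_prod; apply: eq_big_nat => i le_i.
  rewrite gmulfV gmulfXn ft //; lia.
Qed.

Section PresentedGroup.

Variables (p e r : nat) (G : finGroupType) (s : nat -> G) (b : G).
Hypothesis r_bounds : (1 <= r <= p - 1)%N.
Hypothesis G_pres : G_presented p e r s b.

(** The subgroup [H] contains every [s i] and satisfies the relations, so the universal property
    maps [G] to [H]. Followed by the inclusion [iota], this map fixes the generators, hence is the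
    identity by uniqueness. *)
Lemma presented_gen : <<[set s 1%N; b]>> = [set: G].
Proof.
have [[_ [_ s_rec _]] univ] := G_pres.
pose H := <<[set s 1%N; b]>>%G.
have [Hs1 Hb] : s 1%N \in H /\ b \in H by rewrite !mem_gen ?set21 ?set22.
have Hs i : (1 <= i <= p - 1)%N -> s i \in H.
  elim: i => [|[|i] IHi] // le_i.
  by rewrite s_rec ?groupR ?IHi //; lia.
pose iota : UMagmaMorphism.type (subg_of H) G :=
  HB.pack (@sgval _ H)
    (isMultiplicative.Build _ _ (@sgval _ H) (fun x y => erefl))
    (Multiplicative_isUMagmaMorphism.Build _ _ (@sgval _ H) erefl).
have rel_H : G_relations p e r (fun i => subg H (s i)) (subg H b).
  apply: (@G_relations_inj _ _ _ _ _ iota s b) => //=.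
  - exact: subg_inj.
  - by move=> i le_i; rewrite subgK ?Hs.
  - by rewrite subgK.
  - by case: G_pres.
have [[f [fs fb]] _] := univ _ _ _ rel_H.
have [_ uniq_id] := univ _ _ _ G_pres.1.
apply/eqP; rewrite -subTset; apply/subsetP=> x _.
have <- : (iota \o f) x = x.
  apply: (uniq_id (iota \o f) idfun) => //; split=> [i le_i|] /=.
    by rewrite fs // subgK ?Hs.
  by rewrite fb subgK.
exact: subgP.
Qed.

Hypotheses (p_prime : prime p) (p_odd : odd p).

Lemma presented_odd_order_s1 : odd #[s 1%N].
Proof.
have [[[s_exp _ _] _] _] := G_pres.
have: #[s 1%N] %| p ^ e by rewrite order_dvdn s_exp //; lia.
by move/dvdn_odd->; rewrite // oddX p_odd orbT.
Qed.

(** Squaring is an endomorphism of the abelian group [A], so the squares of a commutator chain form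
    a chain again, to which [expg_mul_chain] applies. *)
Lemma presented_expg_mul_b_s1_sqr : (b * s 1%N ^+ 2) ^+ p = 1.
Proof.
have [[[_ _ bp] [s_comm s_rec s_last]] _] := G_pres.
have p_gt1 := prime_gt1 p_prime.
pose A := <<[set s (i : 'I_p.-1).+1 | i : 'I_p.-1]>>%G.
have As i : (1 <= i < p)%N -> s i \in A.
  case: i => // i le_i; rewrite mem_gen //; apply/imsetP.
  have lt_i : (i < p.-1)%N by lia.
  by exists (Ordinal lt_i).
have abA : abelian A.
  rewrite abelian_gen; apply/centsP=> _ /imsetP[i _ ->] _ /imsetP[j _ ->].
  apply/commgP/eqP/s_comm; have := ltn_ord i; have := ltn_ord j; lia.
(* The chain gets a [p]-th term. As its binomial exponent is 1, the last relation says that the full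
   product is trivial. *)
pose t i := if (i < p)%N then s i else [~ s (p - 1)%N, b].
have At i : (1 <= i <= p)%N -> t i \in A.
  move=> le_i; rewrite /t; case: ifP => lt_i; first by apply: As; lia.
  rewrite s_last big_nat; apply: group_prod => j le_j.
  by rewrite groupV groupX ?As.
have tJ i : (1 <= i < p)%N -> t i ^ b = t i * t i.+1.
  move=> /andP[i_gt0 lt_i]; rewrite conjg_mulR /t lt_i; congr (_ * _).
  case: ifP => lt_i1; first by rewrite s_rec //; lia.
  by congr [~ s _, _]; lia.
have prod_t : \prod_(1 <= i < p.+1) t i ^+ 'C(p, i) = 1.
  rewrite big_nat_recr ?prime_gt0 //= binn expg1 {2}/t ltnn s_last.
  have -> : \prod_(1 <= i < p) t i ^+ 'C(p, i) =
      \prod_(1 <= i < p) s i ^+ 'C(p, i).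
    by apply: eq_big_nat => i /andP[_ lt_i]; rewrite /t lt_i.
  (* Writing [p] as a successor gives the product the upper bound required by
     [prodg_abelian_split]. *)
  case: (p) (prime_gt0 p_prime) As => // q _ As'.
  rewrite -(prodg_abelian_split abA) => [|i le_i|i le_i].
  - by apply: big1 => i _; rewrite mulgV.
  - by rewrite groupX ?As'.
  - by rewrite groupV groupX ?As'.
have -> : s 1%N = t 1%N by rewrite /t p_gt1.
rewrite (@expg_mul_chain _ A b (fun i => t i ^+ 2) abA p) //
  => [|i le_i|i le_i].
- rewrite bp mul1g  -[RHS]mulg1.
  transitivity ((\prod_(1 <= i < p.+1) t i ^+ 'C(p, i)) *
                \prod_(1 <= i < p.+1) t i ^+ 'C(p, i)); last by rewrite prod_t.
  rewrite -(prodg_abelian_split abA) => [|i le_i|i le_i].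
  + by apply: eq_big_nat => i _; rewrite -expgM mulnC expgM expgS expg1.
  + by rewrite groupX ?At.
  + by rewrite groupX ?At.
- by rewrite groupX ?At.
rewrite conjXg tJ // expgMn //.
by apply: (centsP abA); apply: At; lia.
Qed.

Variable m : nat.
Hypotheses (m_gt1 : (1 < m)%N) (G_order : #|[set: G]| = (p ^ m)%N).

Lemma presented_noncyclic x : x ^+ p = 1 -> <[x]> != [set: G].
Proof.
move=> xp; apply/eqP=> defG.
have: #[x] %| p by rewrite order_dvdn xp.
rewrite orderE defG G_order => /(dvdn_leq (prime_gt0 p_prime)).
by rewrite leqNgt -{1}[p]expn1 ltn_exp2l ?m_gt1 ?prime_gt1.
Qed.

Lemma presented_s1_neq1 : s 1%N != 1.
Proof.
have [[[_ _ bp] _] _] := G_pres.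
apply: contraNneq (presented_noncyclic bp) => s1.
rewrite eqEsubset subsetT -presented_gen gen_subG subUset !sub1set.
by rewrite s1 group1 cycle_id.
Qed.

Lemma presented_order_b : #[b] = p.
Proof.
have [[[_ _ bp] [_ s_rec s_last]] _] := G_pres.
apply: nt_prime_order => //; apply/eqP=> b1.
(* If [b] is trivial, the chain collapses after [s 1]. The last relation retains only its factor of
   index 1, which gives [s 1 ^+ p = 1] and makes [G] cyclic of order at most [p]. *)
have s_eq1 k : (2 <= k <= p - 1)%N -> s k = 1.
  case: k => [|[|k]] // le_k; rewrite s_rec; last lia.
  by rewrite b1 commg1.
have s1p : s 1%N ^+ p = 1.
  have p_gt1 := prime_gt1 p_prime.
  move: s_last; rewrite b1 commg1 big_ltn // big_nat big1 => [|i le_i].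
    by rewrite bin1 mulg1 => /esym/eqP; rewrite invg_eq1 => /eqP.
  by rewrite s_eq1 ?expg1n ?invg1 //; lia.
case/eqP: (presented_noncyclic s1p).
apply/eqP; rewrite eqEsubset subsetT -presented_gen gen_subG subUset !sub1set.
by rewrite b1 group1 cycle_id.
Qed.

End PresentedGroup.

(** * The automorphisms [sigma] and [tau], and the semidirect product *)

Lemma eq_Aut_gen2 (gT : finGroupType) (x y : gT) (f g : {perm gT}) :
    <<[set x; y]>> = [set: gT] -> f \in Aut [set: gT] -> g \in Aut [set: gT] ->
  f x = g x -> f y = g y -> f = g.
Proof.
move=> defG Af Ag fgx fgy; apply/permP=> z.
have gK: group_set [set w | f w == g w].
  have autM h (Ah : h \in Aut [set: gT]) v w : h (v * w) = h v * h w.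
    by apply: (morphM (autm_morphism Ah)); rewrite inE.
  apply/group_setP; split=> [|v w]; rewrite !inE.
    rewrite [f 1](morph1 (autm_morphism Af)).
    by rewrite [g 1](morph1 (autm_morphism Ag)).
  by rewrite !autM // => /eqP-> /eqP->.
have /subsetP/(_ z (in_setT _)): [set: gT] \subset Group gK.
  by rewrite -defG gen_subG subUset !sub1set !inE fgx fgy !eqxx.
by rewrite inE => /eqP.
Qed.

Theorem theorem1p1 (p e r m : nat)
    (p_prime : prime p) (p_odd : odd p)
    (e_ge1 : (1 <= e)%N) (r_bounds : (1 <= r <= p - 1)%N)
    (m_def : m = (e * r + (e - 1) * (p - r - 1) + 1)%N) (m_ge3 : (3 <= m)%N)
    (G : finGroupType) (s : nat -> G) (beta : G)
    (G_pres : G_presented p e r s beta)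
    (G_order : #|[set: G]| = (p ^ m)%N)
    (sigma tau : {perm G})
    (sigma_aut : sigma \in Aut [set: G]) (tau_aut : tau \in Aut [set: G])
    (sigma_s1 : sigma (s 1%N) = s 1%N) (sigma_beta : sigma beta = beta^-1)
    (tau_s1 : tau (s 1%N) = (s 1%N)^-1) (tau_beta : tau beta = beta) :
  let R := Aut_sdprod (gen2_Aut sigma_aut tau_aut) in
  #|[set: R]| = (4 * p ^ m)%N /\
  exists rho : 'I_3 -> R,
    string_C_group [set: R] rho /\ schlafli_type rho = [:: p; (2 * p)%N].
Proof.
have p_gt2 : (2 < p)%N by rewrite odd_prime_gt2.
have m_gt1: (1 < m)%N by lia.
have defG := presented_gen r_bounds G_pres.
have ob := presented_order_b r_bounds G_pres p_prime p_odd m_gt1 G_order.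
have s1_neq1 := presented_s1_neq1 r_bounds G_pres p_prime m_gt1 G_order.
have odd_s1 := presented_odd_order_s1 r_bounds G_pres p_prime p_odd.
have bs1p := presented_expg_mul_b_s1_sqr r_bounds G_pres p_prime p_odd.
(* This separates [sigma] and [tau] from the identity and from each other, by their values on [s 1]
   and [beta]. *)
have odd_inv_neq (x : G) : odd #[x] -> x != 1 -> x^-1 != x.
  move=> odd_x; apply: contraNneq => xV.
  have: x \in [1 G].
    apply: odd_order_mem_sqr => //.
    by rewrite expgS expg1 -{1}xV mulVg group1.
  by rewrite inE.
have b_neq1: beta != 1 by rewrite -order_gt1 ob prime_gt1.
have autE f g := @eq_Aut_gen2 _ _ _ f g defG.
have A1 : 1 \in Aut [set: G] by apply: group1.
have autV (f : {perm G}) x : f \in Aut [set: G] -> f x^-1 = (f x)^-1.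
  by move=> Af; apply: (morphV (autm_morphism Af)); rewrite inE.
have ssigma: sigma * sigma = 1.
  apply: autE; rewrite ?groupM // !permM perm1 ?sigma_s1 ?sigma_beta //.
  by rewrite autV // sigma_beta invgK.
have ttau: tau * tau = 1.
  apply: autE; rewrite ?groupM // !permM perm1 ?tau_s1 ?tau_beta //.
  by rewrite autV // tau_s1 invgK.
have cst: commute sigma tau.
  apply: autE; rewrite ?groupM // !permM;
    rewrite ?(sigma_s1, tau_s1, sigma_beta, tau_beta) autV //.
    by rewrite sigma_s1.
  by rewrite tau_beta.
have osigma: #[sigma] = 2.
  apply: order2_sqr1 => //; apply: contraNneq (odd_inv_neq _ _ b_neq1) => [s1|].
    by rewrite -sigma_beta s1 perm1.
  by rewrite ob.
have otau: #[tau] = 2.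
  apply: order2_sqr1 => //.
  apply: contraNneq (odd_inv_neq _ odd_s1 s1_neq1) => t1.
  by rewrite -tau_s1 t1 perm1.
have ne_st: sigma != tau.
  apply: contraNneq (odd_inv_neq _ odd_s1 s1_neq1) => st.
  by rewrite -tau_s1 -st sigma_s1.
have ost: #[sigma * tau] = 2.
  apply: order2_sqr1; last by rewrite {2}cst mulgA -(mulgA sigma) ttau mulg1.
  apply: contra ne_st => /eqP st1; apply/eqP/(mulIg tau).
  by rewrite st1 ttau.
have oA: #|<<[set sigma; tau]>>| = 4 by rewrite card_involutions_gen // ost.
set sAG := gen2_Aut _ _; pose to := ([Aut [set: G]] \ sAG)%gact.
move=> R.
have defR := sdprod_sdpair to.
have [As At]: sigma \in <<[set sigma; tau]>> /\ tau \in <<[set sigma; tau]>>.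
  by rewrite !mem_gen ?set21 ?set22.
have oR: #|[set: R]| = (4 * p ^ m)%N.
  rewrite -(sdprod_card defR) !card_injm ?injm_sdpair1 ?injm_sdpair2 //.
  by rewrite oA G_order mulnC.
split=> //.
(* The images in [R] of the two generators and the two automorphisms are shown to satisfy the
   hypotheses on [s], [b], [u], [t]. *)
pose S := sdpair1 to (s 1%N); pose B := sdpair1 to beta.
pose u := sdpair2 to sigma; pose t := sdpair2 to tau.
have defN: <<[set S; B]>> = sdpair1 to @* [set: G].
  by rewrite -defG morphim_gen ?subsetT // morphimU !morphim_set1 ?inE.
have defQ: <<[set u; t]>> = sdpair2 to @* <<[set sigma; tau]>>.
  rewrite morphim_gen ?subset_gen // morphimU !morphim_set1 //.
have actE a x : a \in <<[set sigma; tau]>> -> to x a = a x.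
  done.
have conj1 x a : a \in <<[set sigma; tau]>> ->
    sdpair1 to x ^ sdpair2 to a = sdpair1 to (a x).
  by move=> Aa; rewrite -(sdpair_act to) ?inE ?actE.
have p1V x : sdpair1 to x^-1 = (sdpair1 to x)^-1 by rewrite morphV ?inE.
have p1X n x : sdpair1 to (x ^+ n) = sdpair1 to x ^+ n by rewrite morphX ?inE.
have p1M x y : sdpair1 to (x * y) = sdpair1 to x * sdpair1 to y.
  by rewrite morphM ?inE.
have Su : S ^ u = S by rewrite conj1 ?sigma_s1.
have Bu : B ^ u = B^-1 by rewrite conj1 // sigma_beta p1V.
have St : S ^ t = S^-1 by rewrite conj1 // tau_s1 p1V.
have Bt : B ^ t = B by rewrite conj1 // tau_beta.
have o1 x : #[sdpair1 to x] = #[x] by rewrite order_injm ?injm_sdpair1 ?inE.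
have o2 a : a \in <<[set sigma; tau]>> -> #[sdpair2 to a] = #[a].
  by move=> Aa; rewrite order_injm ?injm_sdpair2.
have ou : #[u] = 2 by rewrite o2.
have ot : #[t] = 2 by rewrite o2.
have oB : #[B] = p by rewrite o1.
have oS : odd #[S] by rewrite o1.
have cut : commute u t by rewrite /commute -!morphM // cst.
have BSp : (B * S ^+ 2) ^+ p = 1 by rewrite -p1X -p1M -p1X bs1p morph1.
(* The images of the two factors meet trivially, and [t] has order 2. *)
have N't : t \notin <<[set S; B]>>.
  apply/negP=> Nt.
  have: t \in sdpair1 to @* [set: G] :&:
      sdpair2 to @* <<[set sigma; tau]>>.
    by rewrite inE -defN Nt mem_morphim.
  by rewrite im_sdpair_TI inE -order_eq1 ot.
have defNQ : <<[set S; B]>> <*> <<[set u; t]>> = [set: R].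
  by rewrite defN defQ; case/sdprodP: defR => _ <- nQN _; rewrite norm_joinEr.
have cardR : (4 * p < #|[set: R]|)%N.
  by rewrite oR ltn_pmul2l // -{1}[p]expn1 ltn_exp2l // prime_gt1.
exists (twisted_rho S B u t); split.
  exact: (string_C_group_twisted_rho p_prime p_odd Su Bu St Bt ou ot cut oB oS
    BSp N't defNQ cardR).
exact: (schlafli_twisted_rho p_prime p_odd Su Bu St Bt ou ot cut oB BSp N't).
Qed.
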